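(* For every $d\ge 1$ there exist constants $\beta_d>0$ and $C_d>0$, depending only on $d$, such that the following holds. Let $S\subset\mathbb{R}^d$ be a compact set with \[ \mathrm{diam}(S)\le 1+\beta\qquad\text{and}\qquad \mathtt{rad}(S)\ge \mathrm{Jung}_d \] for some $0\le\beta\le\beta_d$. Then there exists a set $\Delta=\{x_0,\dots,x_d\}\subset\mathbb{R}^d$ which is the vertex set of a regular simplex of edge length $1$ such that every witness $W\subseteq S$ satisfies $\mathrm{dist}_H(W,\Delta)\le C_d\beta$.
   Context: $\mathrm{Jung}_d:=\sqrt{\frac{d}{2(d+1)}}$. For a bounded set $A\subset\mathbb{R}^d$, its Chebyshev radius is $\mathtt{rad}(A)=\inf_{c\in\mathbb{R}^d}\sup_{y\in A}\|c-y\|_2$ (the radius of the smallest enclosing ball), and $\mathrm{diam}(A)=\sup_{x,y\in A}\|x-y\|_2$. A witness for $S$ is a subset $W\subseteq S$ of cardinality $d+1$ with $\mathtt{rad}(W)\ge\mathrm{Jung}_d$. A regular simplex of edge length $1$ is a set of $d+1$ points of $\mathbb{R}^d$ at pairwise distance exactly $1$. For nonempty compact $A,B\subset\mathbb{R}^d$, the Hausdorff distance is $\mathrm{dist}_H(A,B)=\max\{\sup_{a\in A}\inf_{b\in B}\|a-b\|_2,\ \sup_{b\in B}\inf_{a\in A}\|a-b\|_2\}$. *)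

(* Defs.v *)
From HB Require Import structures.
From mathcomp Require Import all_boot all_order all_algebra.
From mathcomp Require Import all_classical all_reals all_analysis.
From mathcomp Require Import Rstruct Rstruct_topology.
From Stdlib Require Import Reals.

Set Implicit Arguments.
Unset Strict Implicit.
Unset Printing Implicit Defensive.

Import Order.TTheory GRing.Theory Num.Theory.
Local Open Scope classical_set_scope.
Local Open Scope ring_scope.

Notation Rl := Rdefinitions.R.

Definition edist (d : nat) (x y : 'rV[Rl]_d) : Rl :=
  Num.sqrt (\sum_(i < d) (x ord0 i - y ord0 i) ^+ 2).

Definition Jung (d : nat) : Rl := Num.sqrt (d%:R / (2 * (d.+1)%:R)).

(* diam A = sup_{x,y in A} |x - y|  (used for bounded A). *)
Definition diam (d : nat) (A : set 'rV[Rl]_d) : Rl :=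
  sup [set edist x y | x in A & y in A].

(* Chebyshev radius: rad A = inf_c sup_{y in A} |c - y|  (used for bounded A). *)
Definition cheb_rad (d : nat) (A : set 'rV[Rl]_d) : Rl :=
  inf [set sup [set edist c y | y in A] | c in [set: 'rV[Rl]_d]].

Definition witness (d : nat) (S W : set 'rV[Rl]_d) : Prop :=
  [/\ W `<=` S,
      exists f : 'I_d.+1 -> 'rV[Rl]_d, injective f /\ W = range f
    & Jung d <= cheb_rad W].

Definition regular_unit_simplex (d : nat) (x : 'I_d.+1 -> 'rV[Rl]_d) : Prop :=
  forall i j : 'I_d.+1, i != j -> edist (x i) (x j) = 1.

(* Hausdorff distance (used for nonempty compact A, B). *)
Definition distH (d : nat) (A B : set 'rV[Rl]_d) : Rl :=
  Num.max (sup [set inf [set edist a b | b in B] | a in A])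
          (sup [set inf [set edist a b | a in A] | b in B]).

(* Compactness of A ⊆ R^d (library notion on the product topology of 'rV). *)
Definition compact_set (d : nat) (A : set 'rV[Rl]_d) : Prop :=
  topology_theory.compact.compact A.

(* Main.v *)
Require Import Defs.
From HB Require Import structures.
From mathcomp Require Import all_boot all_order all_algebra.
From mathcomp Require Import all_classical all_reals all_analysis.
From mathcomp Require Import Rstruct Rstruct_topology.
From mathcomp Require Import ring lra.
Import Order.TTheory GRing.Theory Num.Theory.
Import numFieldNormedType.Exports.
Local Open Scope classical_set_scope.
Local Open Scope ring_scope.

Set Implicit Arguments.
Unset Strict Implicit.
Unset Printing Implicit Defensive.

(** Write n = d + 1. Let l maximise the variance sum_{i<j} l_i l_j |w_i - w_j|^2
of a witness w over the probability vectors. The first order condition says that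
the ball around sum_i l_i w_i whose squared radius is this variance contains w,
so the variance is at least Jung_d^2. Comparing with the upper bound
|w_i - w_j| <= 1 + beta forces the weights to be close to 1/n and all the
distances to be at least 1 - O(beta); an inductive perturbation then moves w by
O(beta) onto a regular simplex x with centroid c. Every point of S is within
1 + O(beta) of all vertices of x, hence within Jung_d + O(beta) of c, as in the
Reuleaux simplex. The weights of a further witness f therefore force each of
its points to be at distance Jung_d - O(beta) at least from c, and the only
points of the Reuleaux simplex that far from c are close to its vertices.
Different points of f are close to different vertices, as they are almost at
distance 1. If S contains no witness, any regular simplex will do. *)

(** * Squared norms *)

Definition dot (R : realType) (d : nat) (u v : 'rV[R]_d) : R :=
  \sum_(i < d) u ord0 i * v ord0 i.
Definition nsq (R : realType) (d : nat) (u : 'rV[R]_d) : R := dot u u.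

Section Dot.
Variables (R : realType) (d : nat).
Implicit Types (u v w : 'rV[R]_d) (a : R).

Lemma dotC u v : dot u v = dot v u.
Proof. by apply: eq_bigr => i _; rewrite mulrC. Qed.
Lemma dotDl u v w : dot (u + v) w = dot u w + dot v w.
Proof. by rewrite -big_split; apply: eq_bigr => i _; rewrite mxE mulrDl. Qed.
Lemma dotZl a u v : dot (a *: u) v = a * dot u v.
Proof. by rewrite mulr_sumr; apply: eq_bigr => i _; rewrite mxE mulrA. Qed.
Lemma dotNl u v : dot (- u) v = - dot u v.
Proof. by rewrite -scaleN1r dotZl mulN1r. Qed.
Lemma dotBl u v w : dot (u - v) w = dot u w - dot v w.
Proof. by rewrite dotDl dotNl. Qed.
Lemma dotDr u v w : dot w (u + v) = dot w u + dot w v.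
Proof. by rewrite dotC dotDl !(dotC w). Qed.
Lemma dotZr a u v : dot u (a *: v) = a * dot u v.
Proof. by rewrite dotC dotZl dotC. Qed.
Lemma dotBr u v w : dot w (u - v) = dot w u - dot w v.
Proof. by rewrite dotC dotBl !(dotC w). Qed.
Lemma dot_suml (I : finType) (F : I -> 'rV[R]_d) v :
  dot (\sum_i F i) v = \sum_i dot (F i) v.
Proof.
apply: (big_morph (fun u => dot u v)) => [u w|]; first exact: dotDl.
by rewrite -(scale0r 0) dotZl mul0r.
Qed.

Lemma nsq_ge0 u : 0 <= nsq u.
Proof. by apply: sumr_ge0 => i _; rewrite -expr2 sqr_ge0. Qed.

Lemma nsq_eq0 u : nsq u = 0 -> u = 0.
Proof.
move=> h; apply/rowP => i; rewrite mxE.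
have H : forall j : 'I_d, true -> 0 <= u ord0 j * u ord0 j.
  by move=> j _; rewrite -expr2 sqr_ge0.
have /eqP := psumr_eq0P H h (isT : true) (i := i).
by rewrite mulf_eq0 orbb => /eqP.
Qed.

Lemma nsqD u v : nsq (u + v) = nsq u + 2 * dot u v + nsq v.
Proof. rewrite /nsq dotDl !dotDr (dotC v u); ring. Qed.
Lemma nsqB u v : nsq (u - v) = nsq u - 2 * dot u v + nsq v.
Proof. rewrite /nsq dotBl !dotBr (dotC v u); ring. Qed.
Lemma nsqZ a u : nsq (a *: u) = a ^+ 2 * nsq u.
Proof. by rewrite /nsq dotZl dotZr mulrA expr2. Qed.
Lemma nsqBC u v : nsq (u - v) = nsq (v - u).
Proof. by rewrite !nsqB (dotC v u); ring. Qed.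
Lemma nsqB_le u v : nsq (u - v) <= 2 * nsq u + 2 * nsq v.
Proof. have := nsq_ge0 (u + v); rewrite nsqD nsqB; lra. Qed.

(** Cauchy-Schwarz, from expanding [0 <= nsq (nsq v *: u - dot u v *: v)] and cancelling [nsq v],
    which is why a null [v] is treated apart. *)
Lemma dot_le u v (r s : R) : 0 <= r -> 0 <= s ->
  nsq u <= r ^+ 2 -> nsq v <= s ^+ 2 -> `|dot u v| <= r * s.
Proof.
move=> r0 s0 ur vs.
have CS : (dot u v) ^+ 2 <= nsq u * nsq v.
  have [v0|v0] := eqVneq (nsq v) 0.
    by rewrite (nsq_eq0 v0) -[X in dot u X](scale0r 0) dotZr mul0r expr0n mulr_ge0 ?nsq_ge0.
  have vp : 0 < nsq v by rewrite lt_def v0 nsq_ge0.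
  have := nsq_ge0 (nsq v *: u - dot u v *: v).
  rewrite nsqB !nsqZ dotZl dotZr => h.
  have : 0 <= nsq v * (nsq u * nsq v - dot u v ^+ 2) by lra.
  by rewrite pmulr_rge0 // subr_ge0.
rewrite -(@ler_pXn2r _ 2) ?nnegrE ?mulr_ge0 // real_normK ?num_real //.
apply: (le_trans CS); rewrite exprMn; apply: ler_pM; rewrite ?nsq_ge0 //.
Qed.
End Dot.

(** * Regular simplices *)

Section Simplex.
Variables (R : realType) (d k : nat) (x : 'I_k -> 'rV[R]_d).
Definition centroid : 'rV[R]_d := k%:R^-1 *: \sum_i x i.
Hypothesis k0 : (0 < k)%N.
Let k0' : (k%:R : R) != 0. Proof. by rewrite pnatr_eq0 -lt0n. Qed.
Local Notation c := centroid.

Lemma sum_dot_centroid v : \sum_i dot v (x i - c) = 0.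
Proof.
under eq_bigr do rewrite dotBr.
rewrite sumrB sumr_const card_ord /centroid dotZr -[X in _ - X]mulr_natl mulrA divff // mul1r.
rewrite (dotC v) dot_suml; apply/eqP; rewrite subr_eq0; apply/eqP.
by apply: eq_bigr => i _; rewrite dotC.
Qed.

Lemma nsqB_centroid z i :
  nsq (z - x i) = nsq (z - c) - 2 * dot (z - c) (x i - c) + nsq (x i - c).
Proof. by rewrite -nsqB; congr nsq; rewrite opprB addrA subrK. Qed.

Hypothesis reg : forall i j, i != j -> nsq (x i - x j) = 1.
(* Squared circumradius of a regular simplex with [k] vertices and unit edges;
   [rho R d.+1 = Jung d ^+ 2]. *)
Definition rho : R := (k%:R - 1) / (2 * k%:R).

(** Parallel axis identity: the cross terms cancel because the vectors [x i - c] add up to zero. *)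
Lemma sum_nsq z : \sum_i nsq (z - x i) = k%:R * nsq (z - c) + \sum_i nsq (x i - c).
Proof.
under eq_bigr do rewrite nsqB_centroid.
rewrite big_split /= sumrB sumr_const card_ord -mulr_sumr sum_dot_centroid.
rewrite -mulr_natl; ring.
Qed.

(** Taking [z = x j] in [sum_nsq] makes the left side [k - 1] for every [j], so all vertices are
    equally far from [c]; summing over [j] then fixes the common value. *)
Lemma nsq_vertex i : nsq (x i - c) = rho.
Proof.
have H j : k%:R * nsq (x j - c) + \sum_i nsq (x i - c) = k%:R - 1.
  rewrite -sum_nsq (bigD1 j) //= subrr (_ : nsq 0 = 0); last first.
    by rewrite -(scale0r 0) nsqZ expr0n mul0r.
  rewrite add0r (eq_bigr (fun=> 1)) => [|i' hi]; last by rewrite reg // eq_sym.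
  rewrite sumr_const -mulr_natl mulr1.
  have := cardC1 j; rewrite card_ord => E.
  rewrite (_ : #|_| = k.-1)%N; last by rewrite -E; apply: eq_card => z; rewrite !inE.
  by rewrite -subn1 natrB.
set T := \sum_i _ in H.
have HT : nsq (x i - c) = (k%:R - 1 - T) / k%:R.
  by apply: (mulfI k0'); rewrite mulrCA divff // mulr1 -(H i); ring.
have : T = \sum_(i < k) ((k%:R - 1 - T) / k%:R).
  by apply: eq_bigr => j _; apply: (mulfI k0'); rewrite mulrCA divff // mulr1 -(H j); ring.
rewrite sumr_const card_ord -[X in _ = X -> _]mulr_natl mulrCA divff // mulr1 => ET.
rewrite HT /rho (_ : T = (k%:R - 1) / 2); last by lra.
by field.
Qed.

Lemma gram i j : dot (x i - c) (x j - c) = ((i == j)%:R - k%:R^-1) / 2.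
Proof.
have [<-|ne] := eqVneq i j.
  by have := nsq_vertex i; rewrite /nsq => ->; rewrite /rho /=; field.
have := nsqB_centroid (x i) j; rewrite reg // !nsq_vertex /rho => h.
apply: (@mulfI _ 2) => //.
suff -> : 2 * dot (x i - c) (x j - c) = 2 * ((k%:R - 1) / (2 * k%:R)) - 1 by rewrite /=; field.
rewrite mulr_natl; lra.
Qed.

(** By [gram], the Gram matrix of the [x i - c] is half the projection onto families of sum zero. On
    such families doubling undoes it, so they can be prescribed as inner products. *)
Lemma dot_comb (p : 'I_k -> R) j : \sum_i p i = 0 ->
  dot (2 *: \sum_i p i *: (x i - c)) (x j - c) = p j.
Proof.
move=> p0; rewrite dotZl dot_suml.
under eq_bigr do rewrite dotZl gram mulrA mulrBr.
rewrite -mulr_suml sumrB -mulr_suml p0 mul0r subr0 (bigD1 j) //= eqxx mulr1.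
rewrite big1 ?addr0 => [|i ne]; first by rewrite mulrC divfK.
by rewrite (negbTE ne) mulr0.
Qed.
End Simplex.

(** * Points of the Reuleaux simplex *)

(* With [a = - n * min p]; the two bounds on [N] cross at [a = 1 / 2], the value at
   the vertices of the Reuleaux simplex. *)
Lemma outer_arith (R : realType) (ni a N eps : R) :
  0 < ni -> ni <= 1 -> 0 <= a -> 0 <= eps -> N <= 2 * a ^+ 2 * (1 - ni) ->
  N <= (1 + ni) / 2 - 2 * a * ni + eps -> N <= (1 - ni) / 2 + eps.
Proof.
move=> ni0 ni1 a0 e0 Na Nm; have [h|h] := lerP (1 / 2) a.
  by have : 1 / 2 * ni <= a * ni; [rewrite ler_pM2r | lra].
have a2 : a ^+ 2 <= 1 / 4 by nra.
have n1 : 0 <= 1 - ni by rewrite subr_ge0.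
by have := ler_wpM2r n1 a2; lra.
Qed.

(** The lower bound on [N] makes both upper bounds nearly sharp, so [a] is near their crossing
    value. Here [t] is the largest of some nonnegative numbers of sum [a] whose squares add up to
    [N / 2 + a ^+ 2 * ni]; as this is nearly [a ^+ 2], [t] carries almost the whole sum. *)
Lemma near_arith (R : realType) (n ni a N eps t : R) :
  2 <= n -> n * ni = 1 -> 0 < ni -> 0 <= a -> 0 <= eps -> n * eps <= 1 / 4 ->
  N <= 2 * a ^+ 2 * (1 - ni) -> N <= (1 + ni) / 2 - 2 * a * ni + eps ->
  (1 - ni) / 2 - eps <= N -> t <= a -> N / 2 + a ^+ 2 * ni <= t * a ->
  `|a - 1 / 2| <= n * eps /\ a - t <= 8 * (n * eps).
Proof.
move=> n2 nni ni0 a0 e0 ne Na Nm lowN ta big.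
have ni2 : ni <= 1 / 2.
  have : 0 <= (n - 2) * ni by rewrite mulr_ge0 ?subr_ge0 // ltW.
  rewrite mulrBl nni; lra.
set e := n * eps in ne *.
have ee : 2 * eps <= e by rewrite ler_wpM2r.
have ene : e * ni = eps by rewrite /e mulrAC nni mul1r.
have aU : a <= 1 / 2 + e.
  rewrite -(ler_pM2r ni0) mulrDl ene; lra.
have a2 : 1 / 4 - eps <= a ^+ 2.
  have h : (1 / 4 - a ^+ 2) * (1 - ni) <= eps / 2 by lra.
  have [//|lt] := lerP (1 / 4 - eps) (a ^+ 2).
  have : 0 <= (1 / 4 - a ^+ 2) * (1 / 2 - ni) by rewrite mulr_ge0 //; lra.
  lra.
have aL : 1 / 2 - e <= a.
  have [//|lt] := lerP (1 / 2 - e) a.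
  have : 0 <= a * (1 / 2 - e - a) by rewrite mulr_ge0 //; lra.
  have : a * e <= 1 / 2 * e by rewrite ler_wpM2r //; lra.
  nra.
have aq : 1 / 4 <= a by lra.
have a2U : a ^+ 2 - 1 / 4 <= 5 / 4 * e.
  have : 0 <= (1 / 2 + e - a) * (a + 1 / 2) by rewrite mulr_ge0 //; lra.
  have : a * e <= (3 / 4) * e by rewrite ler_wpM2r //; lra.
  nra.
(* By the bounds on [t * a] and [N], the left side is at most
   [(a ^+ 2 - 1 / 4) * (1 - ni) + eps / 2]. *)
have h : (a - t) * a <= 2 * e.
  have [h|h] := lerP 0 (a ^+ 2 - 1 / 4); last first.
    have : 0 <= (1 / 4 - a ^+ 2) * (1 - ni) by rewrite mulr_ge0 //; lra.
    lra.
  have : 0 <= (a ^+ 2 - 1 / 4) * ni by rewrite mulr_ge0 // ltW.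
  lra.
split; first by rewrite ler_norml; apply/andP; split; lra.
have : 0 <= (a - t) * (a - 1 / 4) by rewrite mulr_ge0 //; lra.
lra.
Qed.

(* [p i] stands for the inner product of [y - c] with [x i - c], where [x] is a
   regular simplex with centroid [c], and [N] for the squared norm of [y - c]. *)
Section Coordinates.
Variables (R : realType) (d : nat) (p : 'I_d.+1 -> R) (N eps : R).
Hypotheses (p0 : \sum_i p i = 0) (Np : N = 2 * \sum_i p i ^+ 2) (e0 : 0 <= eps)
  (near1 : forall i, N - 2 * p i + rho R d.+1 <= 1 + eps).
Local Notation n := (d.+1%:R : R).
Let ni := n^-1.
Let m := [arg min_(i < ord0) p i]%O.
Let q := - p m.
Let a := n * q.
(** The shift makes the coordinates nonnegative with sum [a]. At a vertex, for [0 < d], one of them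
    is 1/2 and the others vanish. *)
Let s i := p i + q.

Let n0 : n != 0. Proof. by rewrite pnatr_eq0. Qed.
Let nni : n * ni = 1. Proof. by rewrite divff. Qed.
Let ni0 : 0 < ni. Proof. by rewrite invr_gt0 ltr0Sn. Qed.
Let ni1 : ni <= 1. Proof. by rewrite invf_le1 ?ltr0Sn // ler1n. Qed.
Let qa : q = a * ni. Proof. by rewrite /a mulrAC nni mul1r. Qed.
Let rhoE : rho R d.+1 = (1 - ni) / 2.
Proof. by rewrite /rho /ni; field. Qed.
Let s0 i : 0 <= s i.
Proof. by rewrite /s /q subr_ge0 /m; case: arg_minP => //= j _; apply. Qed.
Let sum_s : \sum_i s i = a.
Proof. by rewrite big_split /= p0 add0r sumr_const card_ord /a mulr_natl. Qed.
Let a0 : 0 <= a. Proof. by rewrite -sum_s sumr_ge0. Qed.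
Let sum_s2 : \sum_i s i ^+ 2 = N / 2 + a ^+ 2 * ni.
Proof.
rewrite (eq_bigr (fun i => p i ^+ 2 + q * (2 * p i) + q ^+ 2)); last first.
  by move=> i _; rewrite /s; ring.
rewrite !big_split /= -mulr_sumr -mulr_sumr p0 sumr_const card_ord Np.
rewrite -[X in _ + X]mulr_natl qa (_ : n * _ = a ^+ 2 * ni * (n * ni)); last by ring.
by rewrite nni; field.
Qed.
Let s_le i : s i <= a.
Proof. by rewrite -sum_s (bigD1 i) //= lerDl sumr_ge0. Qed.
(** For nonnegative numbers the sum of squares is at most the square of the sum. *)
Let N_le_a : N <= 2 * a ^+ 2 * (1 - ni).
Proof.
have : \sum_i s i ^+ 2 <= a ^+ 2.
  rewrite expr2 -{1}sum_s mulr_suml; apply: ler_sum => i _.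
  by rewrite expr2 ler_wpM2l.
rewrite sum_s2; lra.
Qed.
(** This is [near1] at the smallest coordinate, which belongs to the vertex farthest from the
    point. *)
Let N_le_min : N <= (1 + ni) / 2 - 2 * a * ni + eps.
Proof.
have := near1 m; rewrite rhoE (_ : p m = - (a * ni)); last by rewrite -qa opprK.
lra.
Qed.

Lemma outer_bound : N <= rho R d.+1 + eps.
Proof.
by rewrite rhoE; apply: (outer_arith ni0 ni1 a0 e0 N_le_a N_le_min).
Qed.

(** The largest shifted coordinate [s k] is close to [a], hence to 1/2, and every other one is
    squeezed between 0 and [a - s k]. *)
Lemma near_coordinates : (0 < d)%N -> rho R d.+1 - eps <= N -> n * eps <= 1 / 4 ->
  exists k, forall i, `|p i - ((i == k)%:R - n^-1) / 2| <= 10 * n * eps.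
Proof.
move=> d0; rewrite rhoE => lowN ne.
have n2 : 2 <= n by rewrite ler_nat.
pose k := [arg max_(i > ord0) p i]%O.
have sk i : s i <= s k by rewrite lerD2r /k; case: arg_maxP => //= j _; apply.
have big : N / 2 + a ^+ 2 * ni <= s k * a.
  rewrite -sum_s2 -sum_s mulr_sumr; apply: ler_sum => i _.
  by rewrite expr2 ler_wpM2r.
have [ha ask] := near_arith n2 nni ni0 a0 e0 ne N_le_a N_le_min lowN (s_le k) big.
have pE i : p i = s i - a * ni by rewrite /s qa addrK.
have ani : `|(a - 1 / 2) * ni| <= eps.
  rewrite normrM (gtr0_norm ni0) (_ : eps = n * eps * ni) ?ler_pM2r //.
  by rewrite mulrAC nni mul1r.
have ee : 2 * eps <= n * eps by rewrite ler_wpM2r.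
exists k => i; rewrite pE -mulrA -/ni.
have h1 := s_le k; have h2 := s0 i.
have h3 : i != k -> s i + s k <= a.
  move=> ne'; rewrite -sum_s (bigD1 i) //= (bigD1 k) ?[k == i]eq_sym //=.
  by rewrite addrA lerDl sumr_ge0.
move: ha ask ani ee h1 h2 h3 e0; have [->|ne'] := eqVneq i k.
  move: (s k) (a) (ni) (n * eps) => S A B E; rewrite !ler_norml /=.
  move=> /andP[? ?] ? /andP[? ?] ? ? ? _ ?; apply/andP; split; lra.
move: (s k) (s i) (a) (ni) (n * eps) => S S' A B E; rewrite !ler_norml /=.
move=> /andP[? ?] ? /andP[? ?] ? ? ? /(_ isT) ? ?; apply/andP; split; lra.
Qed.
End Coordinates.

Section Parseval.
Variables (R : realType) (d : nat) (x : 'I_d.+1 -> 'rV[R]_d).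
Hypothesis reg : forall i j, i != j -> nsq (x i - x j) = 1.
Local Notation c := (centroid x).

(** The [d] edges from [x ord0] have the Gram matrix (I + J) / 2, with J the all-ones matrix. It is
    invertible, so they form a basis, and [r] is orthogonal to each of them. *)
Lemma regular_spans (r : 'rV[R]_d) : (forall j, dot r (x j - c) = 0) -> r = 0.
Proof.
move=> r0; pose y (i : 'I_d) := x (lift ord0 i) - x ord0.
have yy i j : dot (y i) (y j) = (1 + (i == j)%:R) / 2.
  have := nsqB (y i) (y j); rewrite /y {1}opprB addrA subrK.
  rewrite !(@reg _ ord0) ?[lift _ _ == _]eq_sym ?neq_lift //.
  have [<-|ne] := eqVneq i j; last by rewrite reg ?(inj_eq lift_inj) //=; lra.
  by rewrite subrr -(scale0r 0) nsqZ expr0n mul0r /=; lra.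
pose A := \matrix_(i < d, j < d) y i ord0 j.
have Afree : row_free A.
  apply: inj_row_free => z zA.
  have v0 : \sum_i z ord0 i *: y i = 0.
    rewrite -[RHS]zA; apply/rowP => j; rewrite summxE mxE; apply: eq_bigr => i _.
    by rewrite !mxE.
  (* Pairing the vanishing combination with [y j] makes every coefficient minus the sum of all;
     hence [1 + d] times that sum is zero. *)
  have zE j : z ord0 j = - \sum_i z ord0 i.
    have : dot (\sum_i z ord0 i *: y i) (y j) = 0 by rewrite v0 -(scale0r 0) dotZl mul0r.
    rewrite dot_suml (eq_bigr (fun i => z ord0 i / 2 + (z ord0 i * (i == j)%:R) / 2)); last first.
      by move=> i _; rewrite dotZl yy; field.
    rewrite big_split /= -!mulr_suml [X in _ + X / _](bigD1 j) //= eqxx mulr1.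
    by rewrite [X in _ + (_ + X) / _]big1 => [|i ne]; [lra | rewrite (negbTE ne) mulr0].
  have S0 : \sum_i z ord0 i = 0.
    set S := \sum_i _ in zE *.
    have : S = - d%:R * S.
      by rewrite {1}/S (eq_bigr (fun=> - S)) // sumr_const card_ord -mulr_natr; ring.
    move=> h; have : (1 + d%:R) * S = 0 by lra.
    move/eqP; rewrite mulf_eq0 => /orP[|/eqP//].
    by rewrite addrC natr1 pnatr_eq0.
  by apply/rowP => j; rewrite zE S0 oppr0 mxE.
have rA : r *m A^T = 0.
  apply/rowP => j; rewrite !mxE; transitivity (dot r (y j)).
    by apply: eq_bigr => i _; rewrite !mxE.
  rewrite (_ : y j = (x (lift ord0 j) - c) - (x ord0 - c)); first by rewrite dotBr !r0 subrr.
  by rewrite opprB addrA subrK.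
rewrite row_free_unit -unitmx_tr in Afree.
by rewrite -(mulmxK Afree r) rA mul0mx.
Qed.

(** The vectors [x i - c] form a tight frame: by [dot_comb], [v] and its frame expansion have the
    same inner products with all of them, and these vectors span. *)
Lemma parseval (v : 'rV[R]_d) : nsq v = 2 * \sum_i dot v (x i - c) ^+ 2.
Proof.
have vE : v = 2 *: \sum_i dot v (x i - c) *: (x i - c).
  apply/eqP; rewrite -subr_eq0; apply/eqP; apply: regular_spans => j.
  by rewrite dotBl dot_comb ?subrr // sum_dot_centroid.
rewrite {1}/nsq {1}vE dotZl dot_suml; congr (_ * _); apply: eq_bigr => i _.
by rewrite dotZl dotC expr2.
Qed.

Lemma nsqB_vertex z i :
  nsq (z - x i) = nsq (z - c) - 2 * dot (z - c) (x i - c) + rho R d.+1.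
Proof. by rewrite nsqB_centroid nsq_vertex. Qed.

Variables (y : 'rV[R]_d) (eps : R).
Hypotheses (e0 : 0 <= eps) (near1 : forall i, nsq (y - x i) <= 1 + eps).

Lemma reuleaux_outer : nsq (y - c) <= rho R d.+1 + eps.
Proof.
apply: (@outer_bound _ _ (fun i => dot (y - c) (x i - c))) => //.
- exact: sum_dot_centroid.
- exact: parseval.
- by move=> i; rewrite -nsqB_vertex.
Qed.

Lemma reuleaux_near_vertex : (0 < d)%N -> rho R d.+1 - eps <= nsq (y - c) ->
  d.+1%:R * eps <= 1 / 4 ->
  exists k, nsq (y - x k) <= (15 * d.+1%:R ^+ 2 * eps) ^+ 2.
Proof.
move=> d0 lo ne.
have [|||k hk] := @near_coordinates _ _ (fun i => dot (y - c) (x i - c)) _ _ _ _ e0 _ d0 lo ne.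
- exact: sum_dot_centroid.
- exact: parseval.
- by move=> i; rewrite -nsqB_vertex.
exists k; rewrite parseval.
set n : R := d.+1%:R in hk ne *.
have n1 : 1 <= n by rewrite ler1n.
apply: (@le_trans _ _ (2 * \sum_(i < d.+1) (10 * n * eps) ^+ 2)).
  rewrite ler_pM2l //; apply: ler_sum => i _.
  rewrite (_ : y - x k = (y - c) - (x k - c)); last by rewrite opprB addrA subrK.
  rewrite dotBl gram // eq_sym -real_normK ?num_real //.
  by rewrite ler_pXn2r ?nnegrE ?hk // mulr_ge0 // mulr_ge0 // (le_trans _ n1).
rewrite sumr_const card_ord -[X in _ * X]mulr_natl -/n.
have h : 0 <= n ^+ 3 * eps ^+ 2 * (n - 1).
  by rewrite !mulr_ge0 ?exprn_ge0 ?subr_ge0 // (le_trans _ n1).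
have h' : 0 <= n ^+ 3 * eps ^+ 2 by rewrite !mulr_ge0 ?exprn_ge0 // (le_trans _ n1).
(* The constant 15 comes from 200 n^3 <= 225 n^4. *)
have -> : 2 * (n * (10 * n * eps) ^+ 2) = 200 * (n ^+ 3 * eps ^+ 2) by ring.
have -> : (15 * n ^+ 2 * eps) ^+ 2 =
    225 * (n ^+ 3 * eps ^+ 2 * (n - 1)) + 225 * (n ^+ 3 * eps ^+ 2) by ring.
lra.
Qed.
End Parseval.

(** * Perturbation of almost regular simplices *)

(** As [w] is almost equidistant from the vertices, its component [a] along their affine span,
    measured from [c], is O(E), and its height is O(E) away from that of a regular simplex. The new
    vertex stands exactly over [c] at the right height. *)
Lemma regular_extend (R : realType) (d k : nat) (x : 'I_k -> 'rV[R]_d)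
    (w : 'rV[R]_d) (E : R) :
  (0 < k)%N -> (forall i j, i != j -> nsq (x i - x j) = 1) ->
  0 <= E -> (1 + 2 * k%:R) * E <= 1 / 4 ->
  (forall i, `|nsq (w - x i) - 1| <= E) ->
  exists z, (forall i, nsq (z - x i) = 1) /\
            nsq (z - w) <= (4 * (1 + 2 * k%:R) * E) ^+ 2.
Proof.
move=> k0 reg E0 kE near1; set c := centroid x.
have k1 : 1 <= (k%:R : R) by rewrite ler1n.
have kne : (k%:R : R) != 0 by rewrite pnatr_eq0 -lt0n.
set K : R := k%:R in kE k1 kne *.
pose p i := dot (w - c) (x i - c).
have p0 : \sum_i p i = 0 by exact: sum_dot_centroid.
have pE i : 2 * p i = nsq (w - c) + rho R k - nsq (w - x i).
  by rewrite (nsqB_centroid x) nsq_vertex // -/(p i); ring.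
(* Averaging over the vertices cancels the inner products [p i]. *)
have avg : `|nsq (w - c) + rho R k - 1| <= E.
  have h : \sum_i (nsq (w - x i) - 1) = K * (nsq (w - c) + rho R k - 1).
    rewrite sumrB sumr_const card_ord sum_nsq // (eq_bigr (fun=> rho R k)) => [|i _];
      last exact: nsq_vertex.
    by rewrite sumr_const card_ord -[X in _ + X - _]mulr_natl -[X in _ - X]mulr_natl -/K; ring.
  have h2 : `|\sum_i (nsq (w - x i) - 1)| <= K * E.
    apply: le_trans (ler_norm_sum _ _ _) _.
    apply: (@le_trans _ _ (\sum_(i < k) E)); first exact: ler_sum.
    by rewrite sumr_const card_ord mulr_natl.
  by move: h2; rewrite h normrM ger0_norm ?(le_trans _ k1) // ler_pM2l // (lt_le_trans _ k1).
have p_le i : `|p i| <= E.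
  have := near1 i; have := avg; rewrite !ler_norml => /andP[? ?] /andP[? ?].
  by have := pE i; move=> h; apply/andP; split; lra.
pose a := 2 *: \sum_i p i *: (x i - c); pose v := w - c; pose b := v - a.
have bx j : dot b (x j - c) = 0 by rewrite /b dotBl dot_comb // subrr.
have av y : (forall j, dot y (x j - c) = p j) -> dot a y = 2 * \sum_i p i ^+ 2.
  move=> yp; rewrite dotZl dot_suml; congr (_ * _); apply: eq_bigr => i _.
  by rewrite dotZl dotC yp expr2.
have na : nsq a = 2 * \sum_i p i ^+ 2 by apply: av => j; exact: dot_comb.
have na_le : nsq a <= 2 * K * E ^+ 2.
  rewrite na -mulrA ler_pM2l //; apply: (@le_trans _ _ (\sum_(i < k) E ^+ 2)).
    by apply: ler_sum => i _; rewrite -real_normK ?num_real // ler_pXn2r ?nnegrE.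
  by rewrite sumr_const card_ord mulr_natl.
have na0 := nsq_ge0 a.
have nb : nsq b = nsq v - nsq a.
  rewrite /b nsqB (dotC v) (av v) // -na; ring.
pose h2 := 1 - rho R k.
have h2_ge : 1 / 2 <= h2.
  rewrite /h2 /rho -/K (_ : 1 - _ = 1 / 2 + K^-1 / 2); last by field.
  have : 0 < K^-1 by rewrite invr_gt0 (lt_le_trans _ k1). lra.
have KE0 : 0 <= K * E by rewrite mulr_ge0 // (le_trans _ k1).
have E14 : E <= 1 / 4 by lra.
have nb_h : `|nsq b - h2| <= (1 + 2 * K) * E.
  have : E ^+ 2 * K <= E * K by rewrite ler_wpM2r ?(le_trans _ k1) // expr2 ler_piMl //; lra.
  move: avg; rewrite nb /h2 -/v !ler_norml => /andP[? ?] ?.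
  by apply/andP; split; lra.
set D := (1 + 2 * K) * E in nb_h kE *.
have nb_ge : 1 / 4 <= nsq b by move: nb_h; rewrite ler_norml => /andP[? ?]; lra.
pose s := Num.sqrt (nsq b); pose h := Num.sqrt h2.
have s2 : s ^+ 2 = nsq b by rewrite sqr_sqrtr // nsq_ge0.
have hh2 : h ^+ 2 = h2 by rewrite sqr_sqrtr //; lra.
have s0 : 0 < s by rewrite sqrtr_gt0; lra.
have h0 : 0 <= h by exact: sqrtr_ge0.
have h_ge : 1 / 2 <= h by rewrite leNgt; apply/negP => hl; nra.
have s_ge : 1 / 2 <= s by rewrite leNgt; apply/negP => hl; nra.
(* Since [h + s] is at least 1, [h - s] is no larger in absolute value than the difference of the
   squares. *)
have hs : (h - s) ^+ 2 <= D ^+ 2.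
  rewrite -[X in X <= _]real_normK ?num_real // ler_pXn2r ?nnegrE //; last by rewrite (le_trans _ nb_h).
  apply: le_trans nb_h; rewrite -s2 -hh2 subr_sqr normrM distrC ler_peMr //.
  by rewrite ger0_norm; lra.
(* [c + a] is the orthogonal projection of [w] on the affine span of [x]; only the
   height of [w] over it is rescaled. *)
exists (c + (h / s) *: b); split.
  move=> i; rewrite (nsqB_centroid x) -/c nsq_vertex //.
  rewrite [c + _]addrC addrK dotZl bx mulr0 nsqZ -s2 expr_div_n divfK ?expf_neq0 ?gt_eqF //.
  by rewrite hh2 /h2; ring.
rewrite (_ : _ - w = ((h / s - 1) *: b) - a); last first.
  rewrite scalerBl scale1r /b /v; apply/rowP => j; rewrite !mxE; ring.
apply: le_trans (nsqB_le _ _) _; rewrite nsqZ -s2 -exprMn mulrBl divfK ?gt_eqF // mul1r.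
have -> : (4 * (1 + 2 * K) * E) ^+ 2 = 16 * D ^+ 2 by rewrite /D; ring.
have : K * E ^+ 2 <= D ^+ 2.
  rewrite /D exprMn ler_wpM2r ?sqr_ge0 //; nra.
have := sqr_ge0 D; lra.
Qed.

(** Induction on the number of points. Indexing by [nat] lets the same family serve for [k] and
    [k.+1], with all claims limited to the first indices. *)
Lemma regular_approx (R : realType) (d k : nat) :
  exists K : R, 1 <= K /\ forall (w : nat -> 'rV[R]_d) (eps : R),
    0 <= eps -> K * eps <= 1 ->
    (forall i j, (i < k)%N -> (j < k)%N -> i != j -> `|nsq (w i - w j) - 1| <= eps) ->
    exists x : nat -> 'rV[R]_d,
      (forall i j, (i < k)%N -> (j < k)%N -> i != j -> nsq (x i - x j) = 1) /\
      forall i, (i < k)%N -> nsq (x i - w i) <= (K * eps) ^+ 2.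
Proof.
elim: k => [|k [K [K1 IH]]]; first by exists 1; split=> // w eps _ _ _; exists w.
pose M : R := 1 + 2 * k%:R.
have M1 : 1 <= M by rewrite lerDl mulr_ge0.
pose K' := 4 * M * (1 + 5 * K).
have KK' : K <= K'.
  have : 0 <= (M - 1) * (1 + 5 * K) by rewrite mulr_ge0 //; lra.
  rewrite /K'; lra.
exists K'; split; first lra.
move=> w eps e0 Ke near1.
have Keps : K * eps <= 1 by apply: le_trans Ke; rewrite ler_wpM2r.
have Ke0 : 0 <= K * eps by rewrite mulr_ge0 //; lra.
have eK : eps <= K * eps by rewrite ler_peMl.
have Ksq : (K * eps) ^+ 2 <= (K' * eps) ^+ 2.
  by rewrite ler_pXn2r ?nnegrE // ?mulr_ge0 ?ler_wpM2r //; lra.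
have [|x [xreg xw]] := IH w eps e0 Keps.
  by move=> i j ik jk; apply: near1; exact: leqW.
(* A single point stays where it is; [regular_extend] wants a nonempty simplex. *)
case: (posnP k) => [k0|k0].
  exists w; subst k; split; first by move=> [|i] [|j].
  by move=> i _; rewrite subrr -(scale0r 0) nsqZ expr0n mul0r sqr_ge0.
(* Replacing [w i] by [x i] changes the squared distance to [w k] by at most 4 K eps from the cross
   term and (K eps)^2 <= K eps from the square. *)
pose E := (1 + 5 * K) * eps.
have [||||z [zx zw]] := @regular_extend R d k (fun i => x i) (w k) E k0.
- by move=> i j ij; apply: xreg.
- by rewrite mulr_ge0 //; lra.
- rewrite -/M /E; move: Ke; rewrite /K'; lra.
- move=> i; have -> : w k - x i = (w k - w i) - (x i - w i).
    by rewrite opprB addrA subrK.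
  rewrite nsqB.
  have hn : `|nsq (w k - w i) - 1| <= eps by apply: near1; rewrite ?gtn_eqF //; exact: leqW.
  have hx := xw i (ltn_ord i).
  have hd : `|dot (w k - w i) (x i - w i)| <= 2 * (K * eps).
    apply: dot_le => //; move: hn; rewrite ler_norml => /andP[_ ?]; lra.
  have hK : (K * eps) ^+ 2 <= K * eps by rewrite expr2 ler_piMl.
  have := nsq_ge0 (x i - w i); move: hn hd; rewrite /E !ler_norml => /andP[? ?] /andP[? ?] ?.
  by apply/andP; split; lra.
have eq_bound i : (i < k.+1)%N -> (k <= i)%N -> i = k.
  by move=> ik ki; apply/eqP; rewrite eqn_leq -ltnS ik.
exists (fun i => if (i < k)%N then x i else z); split=> [i j ik jk ij|i ik].
  case: (ltnP i k) => hi; case: (ltnP j k) => hj; first exact: xreg.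
  - by rewrite nsqBC (zx (Ordinal hi)).
  - by rewrite (zx (Ordinal hj)).
  - by rewrite (eq_bound _ ik hi) (eq_bound _ jk hj) eqxx in ij.
case: (ltnP i k) => hi; first by apply: le_trans Ksq; exact: xw.
rewrite (eq_bound _ ik hi).
by apply: le_trans zw _; rewrite /K' /E -/M !mulrA.
Qed.

(** The vertices are the basis vectors scaled by 1 / sqrt 2, and one multiple of the all-ones
    vector. *)
Lemma regular_exists (R : realType) (d : nat) : (0 < d)%N ->
  exists x : 'I_d.+1 -> 'rV[R]_d, forall i j, i != j -> nsq (x i - x j) = 1.
Proof.
move=> d0.
have dne : (d%:R : R) != 0 by rewrite pnatr_eq0 -lt0n.
pose r : R := Num.sqrt 2; pose q : R := Num.sqrt (1 + d%:R).
have r2 : r ^+ 2 = 2 by rewrite sqr_sqrtr.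
have q2 : q ^+ 2 = 1 + d%:R by rewrite sqr_sqrtr // addr_ge0.
have rne : r != 0 by rewrite gt_eqF // sqrtr_gt0.
(* The positive root of d t^2 - sqrt 2 * t = 1 / 2, which puts [a] at distance 1 from every
   [e i]. *)
pose t := (1 + q) / (r * d%:R).
pose e (i : 'I_d) : 'rV[R]_d := r^-1 *: delta_mx 0 i.
pose a : 'rV[R]_d := t *: const_mx 1.
have ee i j : dot (e i) (e j) = (i == j)%:R / 2.
  rewrite dotZl dotZr /dot (bigD1 i) //= big1 => [|l li]; last first.
    by rewrite !mxE (negbTE li) andbF mul0r.
  by rewrite !mxE !eqxx mul1r /= addr0 -r2; field.
have ea i : dot (e i) a = t / r.
  rewrite dotZl dotZr /dot (bigD1 i) //= big1 => [|l li]; last first.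
    by rewrite !mxE (negbTE li) andbF mul0r.
  by rewrite !mxE !eqxx /=; field.
have aa : dot a a = t ^+ 2 * d%:R.
  rewrite dotZl dotZr /dot (eq_bigr (fun=> 1)) => [|i _]; last by rewrite !mxE mulr1.
  by rewrite sumr_const card_ord; ring.
have ae i : nsq (a - e i) = 1.
  rewrite nsqB /nsq aa ee eqxx dotC ea /t /=.
  have -> : ((1 + q) / (r * d%:R)) ^+ 2 * d%:R - 2 * ((1 + q) / (r * d%:R) / r) + 1 / 2
    = (q ^+ 2 - 1) / (r ^+ 2 * d%:R) + 1 / 2 by field; rewrite ?rne ?dne.
  by rewrite q2 r2; field.
exists (fun i => if unlift ord0 i is Some j then e j else a) => i j.
case: (unliftP ord0 i) => [i' ->|->]; case: (unliftP ord0 j) => [j' ->|->] ne.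
- rewrite /= nsqB /nsq !ee !eqxx; move: ne; rewrite (inj_eq lift_inj) => /negbTE -> /=; by field.
- by rewrite nsqBC ae.
- by rewrite ae.
- by rewrite eqxx in ne.
Qed.

(** * Weights of a witness *)

(** For squared distances and a probability vector [l] this is twice the variance, as every pair is
    counted in both orders. *)
Definition quad (R : realType) (n : nat) (D : 'I_n -> 'I_n -> R) (l : 'I_n -> R) : R :=
  \sum_i l i * \sum_j l j * D i j.

Lemma continuous_quad (R : realType) (n : nat) (D : 'I_n -> 'I_n -> R) :
  continuous (fun v : 'rV[R]_n => quad D (v ord0)).
Proof.
rewrite /quad; apply: continuous_big => [|i _ v]; first exact: add_continuous.
apply: (@cvgM _ _ (nbhs v)); first exact: coord_continuous.
move: v; apply: continuous_big => [|j _ v]; first exact: add_continuous.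
by apply: (@cvgM _ _ (nbhs v)); [exact: coord_continuous | exact: cvg_cst].
Qed.

Lemma compact_weights (R : realType) (n : nat) :
  compact [set v : 'rV[R]_n | (forall i, 0 <= v ord0 i) /\ \sum_i v ord0 i = 1].
Proof.
have box : compact [set v : 'rV[R]_n | forall i, v ord0 i \in `[(0 : R), 1]].
  by apply: (@rV_compact _ _ (fun=> `[(0 : R), 1]%classic)) => _; exact: segment_compact.
apply: subclosed_compact box _; last first.
  move=> v [v0 v1] i; rewrite in_itv /= v0 -v1 (bigD1 i) //= lerDl.
  by apply: sumr_ge0.
have -> : [set v : 'rV[R]_n | (forall i, 0 <= v ord0 i) /\ \sum_i v ord0 i = 1] =
   (\bigcap_(i in [set: 'I_n]) ((fun v : 'rV[R]_n => v ord0 i) @^-1` [set r | 0 <= r])) `&`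
   ((fun v : 'rV[R]_n => \sum_i v ord0 i) @^-1` [set 1]).
  apply/seteqP; split=> v /=; first by move=> [v0 v1]; split=> // i _; exact: v0.
  by move=> [v0 v1]; split=> // i; exact: v0.
apply: closedI.
  apply: closed_bigI => i _; apply: closed_comp; last exact: closed_ge.
  by move=> v _; exact: coord_continuous.
apply: closed_comp; last exact: closed_eq.
move=> v _; apply: continuous_big => [|j _ w]; first exact: add_continuous.
exact: coord_continuous.
Qed.

Lemma quad_maximizer (R : realType) (n : nat) (D : 'I_n.+1 -> 'I_n.+1 -> R) :
  exists l : 'I_n.+1 -> R, [/\ forall i, 0 <= l i, \sum_i l i = 1 &
    forall m, (forall i, 0 <= m i) -> \sum_i m i = 1 -> quad D m <= quad D l].
Proof.
have [|v /set_mem[v0 v1] vmax] := EVT_max_rV _ (@compact_weights R n.+1)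
    (continuous_subspaceT (@continuous_quad R n.+1 D)).
  exists (delta_mx 0 ord0); split=> [i|]; first by rewrite mxE.
  by rewrite (bigD1 ord0) //= big1 => [|i ne]; rewrite !mxE ?eqxx ?addr0 // (negbTE ne).
exists (v ord0); split=> // m m0 m1.
have := vmax (\row_i m i); rewrite inE /= (_ : (\row_i m i) ord0 = m); first by apply.
by apply/funext => i; rewrite mxE.
Qed.

Lemma sum_mix (R : realType) (n : nat) (l g : 'I_n -> R) (t : R) (i : 'I_n) :
  \sum_j ((1 - t) * l j + t * (j == i)%:R) * g j = (1 - t) * \sum_j l j * g j + t * g i.
Proof.
under eq_bigr do rewrite mulrDl -!mulrA.
rewrite big_split /= -!mulr_sumr; congr (_ + _ * _).
rewrite (bigD1 i) //= eqxx mul1r big1 ?addr0 // => j ne.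
by rewrite (negbTE ne) mul0r.
Qed.

Section Weights.
Variables (R : realType) (d n : nat) (f : 'I_n.+1 -> 'rV[R]_d).

Lemma nsq_barycenter (l : 'I_n.+1 -> R) z : \sum_i l i = 1 ->
  \sum_i l i * nsq (f i - z) =
  \sum_i l i * nsq (f i - \sum_j l j *: f j) + nsq (\sum_j l j *: f j - z).
Proof.
move=> l1; set c := \sum_j l j *: f j.
have dot0 u : \sum_i l i * dot (f i - c) u = 0.
  under eq_bigr do rewrite dotBl mulrBr.
  rewrite sumrB -mulr_suml l1 mul1r /c dot_suml.
  by apply/eqP; rewrite subr_eq0; apply/eqP; apply: eq_bigr => i _; rewrite dotZl.
rewrite (eq_bigr (fun i => l i * nsq (f i - c) + (2 * (l i * dot (f i - c) (c - z))
    + l i * nsq (c - z)))) => [|i _]; last first.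
  by rewrite (_ : f i - z = (f i - c) + (c - z)) ?nsqD ?addrA ?subrK //; ring.
by rewrite !big_split /= -mulr_sumr dot0 -mulr_suml l1 mulr0 mul1r add0r.
Qed.

Lemma circumradius_weights (r : R) : (forall c, exists i, r <= nsq (f i - c)) ->
  exists l : 'I_n.+1 -> R, [/\ forall i, 0 <= l i, \sum_i l i = 1,
    forall z, r <= \sum_i l i * nsq (f i - z) &
    2 * r <= quad (fun i j => nsq (f i - f j)) l].
Proof.
move=> hr; pose D i j := nsq (f i - f j); have [l [l0 l1 lmax]] := quad_maximizer D.
pose c := \sum_j l j *: f j; pose V z := \sum_i l i * nsq (f i - z).
have VE z : V z = V c + nsq (c - z) by exact: nsq_barycenter.
have DC i j : D i j = D j i by exact: nsqBC.
have DV i : \sum_j l j * D i j = V (f i) by apply: eq_bigr => j _; rewrite DC.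
have BV : \sum_i l i * V (f i) = 2 * V c.
  rewrite (eq_bigr (fun i => l i * V c + l i * nsq (f i - c))) => [|i _].
    by rewrite big_split /= -mulr_suml l1 -/(V c); ring.
  by rewrite VE nsqBC mulrDr.
have Bl : quad D l = 2 * V c by rewrite -BV; apply: eq_bigr => i _; rewrite DV.
have Vc0 : 0 <= V c by apply: sumr_ge0 => i _; rewrite mulr_ge0 ?nsq_ge0.
(* Since [V (f i) = V c + nsq (c - f i)], this puts [f i] in the ball of squared radius [V c] around
   [c]. *)
have first_order i : V (f i) <= 2 * V c.
  rewrite leNgt; apply/negP => lt.
  (* Moving the weight [l] towards the vertex [i] cannot increase [quad D]. *)
  have mixE t : quad D (fun j => (1 - t) * l j + t * (j == i)%:R) =
      (1 - t) ^+ 2 * (2 * V c) + 2 * t * (1 - t) * V (f i).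
    rewrite /quad sum_mix sum_mix DV.
    under eq_bigr do rewrite sum_mix DV mulrDr mulrCA [l _ * (t * _)]mulrCA.
    rewrite big_split /= -!mulr_sumr BV -/(V (f i)) /D subrr -(scale0r 0) nsqZ; ring.
  pose G := V (f i) - 2 * V c; have G0 : 0 < G by rewrite subr_gt0.
  pose s := 2 * V c + 2 * G; have s0 : 0 < s by rewrite /s; lra.
  (* The move changes [quad D] by 2 t G - t^2 s, which is largest at this [t], with the positive
     value t G. *)
  pose t := G / s; have t0 : 0 < t by rewrite divr_gt0.
  have t1 : t <= 1 by rewrite ler_pdivrMr // /s; lra.
  have tb : t * s = G by rewrite divfK // gt_eqF.
  have m0 j : 0 <= (1 - t) * l j + t * (j == i)%:R.
    apply: addr_ge0; apply: mulr_ge0; [by rewrite subr_ge0 | exact: l0 | exact: ltW | exact: ler0n].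
  have m1 : \sum_j ((1 - t) * l j + t * (j == i)%:R) = 1.
    have := sum_mix l (fun=> 1) t i; under eq_bigr do rewrite mulr1.
    by move=> ->; under eq_bigr do rewrite mulr1; rewrite l1; ring.
  have := lmax _ m0 m1; rewrite mixE Bl.
  have : 0 < t * G by rewrite mulr_gt0.
  have -> : V (f i) = G + 2 * V c by rewrite /G; ring.
  have : t * (t * s) = t * G by rewrite tb.
  rewrite /s; lra.
have [i hi] := hr c.
have rV : r <= V c.
  by apply: (le_trans hi); have := first_order i; rewrite VE nsqBC; lra.
exists l; split=> //; last by rewrite Bl; lra.
by move=> z; rewrite -/(V z) VE; have := nsq_ge0 (c - z); lra.
Qed.

(** With [W] the squared deviation of the weights from uniform and [T] the weighted defect of the
    distances, [quad] equals (1 + b) (1 - 1/N - W) - T. It is at least 1 - 1/N, so [W] and [T] are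
    both at most [b]. *)
Lemma near_regular_weights (b : R) : (0 < n)%N ->
  (forall c, exists i, rho R n.+1 <= nsq (f i - c)) ->
  (forall i j, nsq (f i - f j) <= 1 + b) -> 0 <= b -> 4 * n.+1%:R ^+ 2 * b <= 1 ->
  exists l : 'I_n.+1 -> R, [/\ forall i, 1 <= 2 * n.+1%:R * l i, \sum_i l i = 1,
    forall z, rho R n.+1 <= \sum_i l i * nsq (f i - z) &
    forall i j, i != j -> 1 - 4 * n.+1%:R ^+ 2 * b <= nsq (f i - f j)].
Proof.
move=> n0 hr near1 b0 bN; have [l [l0 l1 lV lq]] := circumradius_weights hr.
set N : R := n.+1%:R in bN *; have N0 : 0 < N by rewrite ltr0Sn.
have Nne : N != 0 by rewrite gt_eqF.
(* The diagonal is set to zero because a point is not almost at distance 1 from itself; this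
   produces the squares of the weights in [qE]. *)
pose e i j := if i == j then 0 else 1 + b - nsq (f i - f j).
have e0 i j : 0 <= e i j by rewrite /e; case: eqP => // _; rewrite subr_ge0.
pose T := \sum_i \sum_j l i * l j * e i j.
have lle i j : i != j -> l i * l j * e i j <= T.
  move=> ij; rewrite /T (bigD1 i) //= (bigD1 j) //= -addrA lerDl addr_ge0 //.
    by apply: sumr_ge0 => a _; rewrite !mulr_ge0.
  by apply: sumr_ge0 => a _; apply: sumr_ge0 => a' _; rewrite !mulr_ge0.
pose W := \sum_i (l i - N^-1) ^+ 2.
have WE : \sum_i l i ^+ 2 = W + N^-1.
  rewrite /W [X in _ = X + _](eq_bigr (fun i => l i ^+ 2 + (- 2 * N^-1 * l i + N^-1 ^+ 2))) => [|i _]; last by ring.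
  rewrite !big_split /= -mulr_sumr l1 sumr_const card_ord -[X in _ + (_ + X)]mulr_natl -/N.
  by field.
have W0 : 0 <= W by apply: sumr_ge0 => i _; rewrite sqr_ge0.
have qE : quad (fun i j => nsq (f i - f j)) l = (1 + b) * (1 - \sum_i l i ^+ 2) - T.
  have inner i : l i * \sum_j l j * nsq (f i - f j) =
      (1 + b) * l i - (1 + b) * l i ^+ 2 - \sum_j l i * l j * e i j.
    have diag : \sum_j (j == i)%:R * l j = l i.
      rewrite (bigD1 i) //= eqxx mul1r big1 ?addr0 // => j /negbTE ->.
      by rewrite mul0r.
    rewrite mulr_sumr (eq_bigr (fun j => (1 + b) * l i * l j -
      (1 + b) * l i * ((j == i)%:R * l j) - l i * l j * e i j)) => [|j _].
      by rewrite !sumrB -!mulr_sumr l1 diag; ring.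
    rewrite /e [j == i]eq_sym; case: eqP => [<-|_] /=; last by ring.
    by rewrite subrr -(scale0r 0) nsqZ; ring.
  rewrite /quad (eq_bigr _ (fun i _ => inner i)) !sumrB -!mulr_sumr l1 -/T; ring.
have rE : 2 * rho R n.+1 = 1 - N^-1 by rewrite /rho -/N; field.
have Ni : 0 < N^-1 by rewrite invr_gt0.
have Ni1 : N^-1 <= 1 by rewrite invf_le1 // ler1n.
have T0 : 0 <= T by apply: sumr_ge0 => a _; apply: sumr_ge0 => a' _; rewrite !mulr_ge0.
have bW : 0 <= b * W by rewrite mulr_ge0.
have bNi : 0 <= b * N^-1 by rewrite mulr_ge0 // ltW.
rewrite rE qE WE in lq.
have [Wb Tb] : W <= b /\ T <= b.
  by move: lq T0 W0 bW bNi; move: (W) (T) (N^-1) => A B u; split; lra.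
(* A weight below 1/(2N) would alone contribute more than 1/(4N^2) >= b to [W]. *)
have l_ge i : 1 <= 2 * N * l i.
  have h : (l i - N^-1) ^+ 2 <= W.
    by rewrite /W (bigD1 i) //= lerDl; apply: sumr_ge0 => j _; rewrite sqr_ge0.
  rewrite leNgt; apply/negP => lt.
  have h2 : 1 < 4 * N ^+ 2 * (l i - N^-1) ^+ 2.
    have -> : 4 * N ^+ 2 * (l i - N^-1) ^+ 2 = (2 - 2 * N * l i) ^+ 2 by field.
    have : 0 < (1 - 2 * N * l i) by lra.
    move: lt; move: (2 * N * l i) => u lt hu; have := mulr_gt0 hu hu; lra.
  have : 4 * N ^+ 2 * (l i - N^-1) ^+ 2 <= 4 * N ^+ 2 * b.
    by rewrite ler_pM2l ?mulr_gt0 ?exprn_gt0 //; exact: le_trans h Wb.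
  by move=> h3; have := lt_le_trans h2 (le_trans h3 bN); rewrite ltxx.
exists l; split=> // i j ij.
have h := lle _ _ ij.
have h1 : 1 <= (2 * N * l i) * (2 * N * l j).
  by rewrite -[X in X <= _]mulr1 ler_pM.
have h2 : e i j <= 4 * N ^+ 2 * (l i * l j * e i j).
  have -> : 4 * N ^+ 2 * (l i * l j * e i j) = (2 * N * l i) * (2 * N * l j) * e i j by ring.
  by rewrite ler_peMl.
have h3 : 4 * N ^+ 2 * (l i * l j * e i j) <= 4 * N ^+ 2 * b.
  by rewrite ler_pM2l ?mulr_gt0 ?exprn_gt0 //; exact: le_trans h Tb.
by move: h2; rewrite {1}/e (negbTE ij); lra.
Qed.
End Weights.

(** * Stability of witnesses *)

(** The simplex is built from [w] alone, before [f] is given, so that it serves all witnesses at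
    once. *)
Lemma witness_stability (R : realType) (d : nat) : (0 < d)%N ->
  exists C : R, 1 <= C /\ forall beta : R, 0 <= beta -> 4 * C * beta <= 1 ->
  forall w : 'I_d.+1 -> 'rV[R]_d,
    (forall c, exists i, rho R d.+1 <= nsq (w i - c)) ->
    (forall i j, nsq (w i - w j) <= (1 + beta) ^+ 2) ->
  exists x : 'I_d.+1 -> 'rV[R]_d, (forall i j, i != j -> nsq (x i - x j) = 1) /\
  forall f : 'I_d.+1 -> 'rV[R]_d,
    (forall c, exists i, rho R d.+1 <= nsq (f i - c)) ->
    (forall i j, nsq (f i - f j) <= (1 + beta) ^+ 2) ->
    (forall i j, nsq (f i - w j) <= (1 + beta) ^+ 2) ->
  exists k : 'I_d.+1 -> 'I_d.+1, injective k /\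
    forall j, nsq (f j - x (k j)) <= (C * beta) ^+ 2.
Proof.
move=> d0; have [K [K1 approx]] := @regular_approx R d d.+1.
set n : R := d.+1%:R; have n1 : 1 <= n by rewrite ler1n.
have n2 : 1 <= n ^+ 2 by rewrite exprn_ege1.
have n3 : 1 <= n ^+ 3 by rewrite exprn_ege1.
(* [L * beta] bounds the move from [w] to the simplex, and [C] is 15 n^2 * 2 n * 8 L, from
   [reuleaux_near_vertex] at error [2 * n * eps]. Both are kept opaque. *)
have [L LE] : exists L, L = K * (12 * n ^+ 2) by eexists.
have [C CE] : exists C, C = 240 * n ^+ 3 * L by eexists.
have L1 : 12 * n ^+ 2 <= L by rewrite LE ler_peMl //; lra.
have CL : 240 * L <= C.
  by rewrite CE -mulrA [n ^+ 3 * L]mulrC ler_pM2l // ler_peMr //; lra.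
exists C; split; first lra.
move=> beta b0 Cb w wJ wD.
have b1 : 0 <= (n ^+ 2 - 1) * beta by rewrite mulr_ge0 // subr_ge0.
have Lb : 12 * n ^+ 2 * beta <= L * beta by rewrite ler_wpM2r.
have CLb : 240 * L * beta <= C * beta by rewrite ler_wpM2r.
have beta_le : beta <= 1 by lra.
have Lb0 : 0 <= L * beta by lra.
have Lb1 : 240 * (L * beta) <= 1 by lra.
have bsq : beta ^+ 2 <= beta by rewrite expr2 ler_piMl.
pose b := 3 * beta.
have bE : (1 + beta) ^+ 2 <= 1 + b by rewrite /b; lra.
have bn : 4 * n ^+ 2 * b <= 1 / 2 by rewrite /b; lra.
have weights (f : 'I_d.+1 -> 'rV[R]_d) : (forall c, exists i, rho R d.+1 <= nsq (f i - c)) ->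
    (forall i j, nsq (f i - f j) <= (1 + beta) ^+ 2) ->
    exists l : 'I_d.+1 -> R, [/\ forall i, 1 <= 2 * d.+1%:R * l i, \sum_i l i = 1,
      forall z, rho R d.+1 <= \sum_i l i * nsq (f i - z) &
      forall i j, i != j -> 1 - 4 * n ^+ 2 * b <= nsq (f i - f j)].
  move=> fJ fD; apply: near_regular_weights => //; rewrite -/n; last by lra.
  - by move=> i j; apply: le_trans bE.
  - by rewrite /b; lra.
have [_ [_ _ _ wL]] := weights w wJ wD.
have [|||X [Xreg Xw]] := approx (fun i => w (inord i)) (4 * n ^+ 2 * b).
- by rewrite /b; lra.
- rewrite (_ : K * _ = L * beta); [lra | by rewrite LE /b; ring].
- move=> i j ik jk ij.
  have ij' : (inord i : 'I_d.+1) != inord j by rewrite -(inj_eq val_inj) /= !inordK.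
  have := wL _ _ ij'; have := wD (inord i) (inord j).
  rewrite ler_norml => h1 h2; apply/andP; split; first lra.
  have : b <= 4 * n ^+ 2 * b by rewrite /b; lra.
  lra.
pose x (i : 'I_d.+1) := X i.
have xreg i j : i != j -> nsq (x i - x j) = 1 by move=> ij; apply: Xreg.
have xw i : nsq (x i - w i) <= (L * beta) ^+ 2.
  have := Xw i (ltn_ord i); rewrite inord_val (_ : K * _ = L * beta) // LE /b; ring.
exists x; split=> // f fJ fD fw.
(* The excess is 3 beta from the diameter, 4 L beta from the cross term and at most L beta from the
   square, and beta <= L beta. *)
pose eps := 8 * L * beta; have e0 : 0 <= eps by rewrite /eps; lra.
have near1 j i : nsq (f j - x i) <= 1 + eps.
  have -> : f j - x i = (f j - w i) - (x i - w i) by rewrite opprB addrA subrK.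
  have hd : `|dot (f j - w i) (x i - w i)| <= 2 * (L * beta).
    apply: dot_le => //; apply: le_trans (fw j i) _; lra.
  have hL : (L * beta) ^+ 2 <= L * beta by rewrite expr2 ler_piMl //; lra.
  have bL : beta <= L * beta by lra.
  rewrite nsqB /eps; move: (fw j i) (xw i) hd; rewrite ler_norml => ? ? /andP[? _]; lra.
have out j := @reuleaux_outer R d x xreg (f j) eps e0 (near1 j).
have [l [l_ge l1 lJ fL]] := weights f fJ fD.
have l0 i : 0 <= l i.
  have := l_ge i; rewrite -/n => h; rewrite -(@pmulr_rge0 _ (2 * n)) ?mulr_gt0 //; lra.
set c := centroid x in out.
(* The slacks [rho R d.+1 + eps - nsq (f i - c)] are nonnegative with weighted mean at most [eps];
   as each weight is at least 1/(2n), each slack is at most [2 * n * eps]. *)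
have low j : rho R d.+1 - 2 * n * eps <= nsq (f j - c).
  have h : l j * (rho R d.+1 + eps - nsq (f j - c)) <= eps.
    apply: (@le_trans _ _ (\sum_i l i * (rho R d.+1 + eps - nsq (f i - c)))).
      rewrite (bigD1 j) //= lerDl; apply: sumr_ge0 => i _.
      by rewrite mulr_ge0 ?subr_ge0.
    under eq_bigr do rewrite mulrBr.
    by rewrite sumrB -mulr_suml l1 mul1r; have := lJ c; lra.
  have h1 : rho R d.+1 + eps - nsq (f j - c) <=
      2 * n * (l j * (rho R d.+1 + eps - nsq (f j - c))).
    by rewrite mulrA ler_peMl ?subr_ge0.
  have h2 : 2 * n * (l j * (rho R d.+1 + eps - nsq (f j - c))) <= 2 * n * eps.
    by rewrite ler_pM2l ?mulr_gt0 //; lra.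
  lra.
have nC : 15 * n ^+ 2 * (2 * n * eps) = C * beta by rewrite /eps CE; ring.
have e_le : eps <= 2 * n * eps by rewrite ler_peMl //; lra.
have Cb0 : 0 <= C * beta by lra.
have ne : n * (2 * n * eps) <= 1 / 4.
  have : 15 * n ^+ 2 * (2 * n * eps) = 15 * n * (n * (2 * n * eps)) by ring.
  have h : 0 <= n * (2 * n * eps) by rewrite !mulr_ge0 //; lra.
  have : 0 <= (n - 1) * (n * (2 * n * eps)) by rewrite mulr_ge0 // subr_ge0.
  rewrite nC; lra.
have vertex j : exists k, nsq (f j - x k) <= (C * beta) ^+ 2.
  rewrite -nC; apply: reuleaux_near_vertex => //; first lra.
  by move=> i; apply: le_trans (near1 j i) _; rewrite lerD2l.
exists (fun j => xchoose (vertex j)); split; last by move=> j; exact: (xchooseP (vertex j)).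
(* Two points near one vertex would be at squared distance at most 4 (C beta)^2 <= 1/4, while
   distinct points of [f] are at squared distance at least 1/2. *)
move=> i j ij; apply/eqP/negPn/negP => ne_ij.
have hi := xchooseP (vertex i); have hj := xchooseP (vertex j).
rewrite ij in hi; have := fL _ _ ne_ij.
set z := x _ in hi hj; have := nsqB_le (f i - z) (f j - z).
rewrite (_ : f i - z - _ = f i - f j); last by rewrite opprB addrA subrK.
have Csq : (C * beta) ^+ 2 <= 1 / 4 * (1 / 4).
  by rewrite expr2; apply: ler_pM => //; lra.
lra.
Qed.

(** * Diameter, Chebyshev radius and Hausdorff distance *)

Lemma edistE (d : nat) (x y : 'rV[Rl]_d) : Defs.edist x y = Num.sqrt (nsq (x - y)).
Proof.
by congr Num.sqrt; apply: eq_bigr => i _; rewrite !mxE expr2.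
Qed.

Lemma edist_le (d : nat) (x y : 'rV[Rl]_d) (r : Rl) : 0 <= r ->
  (Defs.edist x y <= r) = (nsq (x - y) <= r ^+ 2).
Proof.
move=> r0; rewrite edistE -(@ler_pXn2r _ 2) ?nnegrE ?sqrtr_ge0 //.
by rewrite sqr_sqrtr // nsq_ge0.
Qed.

Lemma edist_ge0 (d : nat) (x y : 'rV[Rl]_d) : 0 <= Defs.edist x y.
Proof. exact: sqrtr_ge0. Qed.

Lemma Jung_rho (d : nat) : Jung d = Num.sqrt (rho Rl d.+1).
Proof. by rewrite /Jung /rho -[in d.+1%:R - 1]natr1 addrK. Qed.

(** Compactness supplies a point of largest norm, hence the upper bound without which [sup] would
    not dominate the distances. *)
Lemma compact_edist_le (d : nat) (S : set 'rV[Rl]_d) (x y : 'rV[Rl]_d) :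
  compact_set S -> S x -> S y -> Defs.edist x y <= diam S.
Proof.
move=> cS Sx Sy; apply: ub_le_sup; last by exists x => //; exists y.
have cn : continuous (fun v : 'rV[Rl]_d => nsq v).
  apply: continuous_big => [|i _ v]; first exact: add_continuous.
  by apply: (@cvgM _ _ (nbhs v)); exact: coord_continuous.
have [|v _ vmax] := EVT_max_rV _ cS (continuous_subspaceT cn); first by exists x.
exists (Num.sqrt (4 * nsq v)) => _ [a Sa [b Sb <-]].
rewrite edistE ler_wsqrtr //; apply: le_trans (nsqB_le _ _) _.
have := vmax a; have := vmax b; rewrite !inE => /(_ Sb) ? /(_ Sa) ?; lra.
Qed.

(** In a finite set the supremum for the centre [c] is attained at the farthest point [f (m c)], and
    the infimum over centres is at most this value. *)
Lemma cheb_rad_range (d : nat) (f : 'I_d.+1 -> 'rV[Rl]_d) :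
  Jung d <= cheb_rad (range f) -> forall c, exists i, rho Rl d.+1 <= nsq (f i - c).
Proof.
move=> fJ c.
pose m z := [arg max_(i > ord0) Defs.edist z (f i)]%O.
have mP z i : Defs.edist z (f i) <= Defs.edist z (f (m z)).
  by rewrite /m; case: arg_maxP => //= j _; apply.
have ub z : ubound [set Defs.edist z y | y in range f] (Defs.edist z (f (m z))).
  by move=> _ [_ [i _ <-] <-].
exists (m c); rewrite nsqBC -(@ler_sqrt _ _ (nsq _)) ?nsq_ge0 // -edistE -Jung_rho.
apply: (le_trans fJ).
apply: (@le_trans _ _ (sup [set Defs.edist c y | y in range f])).
  apply: ge_inf; last by exists c.
  exists 0 => _ [z _ <-]; apply: (@le_trans _ _ (Defs.edist z (f ord0))); first exact: edist_ge0.
  apply: ub_le_sup; first by exists (Defs.edist z (f (m z))); exact: ub.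
  by exists (f ord0) => //; exists ord0.
apply: ge_sup; last exact: ub.
by exists (Defs.edist c (f ord0)); exists (f ord0) => //; exists ord0.
Qed.

(** An injective self-map of a finite type is bijective, so one matching bounds both halves of the
    distance. *)
Lemma distH_range_le (d n : nat) (f x : 'I_n.+1 -> 'rV[Rl]_d)
    (k : 'I_n.+1 -> 'I_n.+1) (r : Rl) :
  injective k -> (forall j, Defs.edist (f j) (x (k j)) <= r) ->
  distH (range f) (range x) <= r.
Proof.
move=> kinj fx; rewrite /distH ge_max; apply/andP; split; apply: ge_sup.
- by eexists; exists (f ord0) => //; exists ord0.
- move=> _ [_ [j _ <-] <-]; apply: le_trans (fx j); apply: ge_inf.
    by exists 0 => _ [? _ <-]; exact: edist_ge0.
  by exists (x (k j)) => //; exists (k j).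
- by eexists; exists (x ord0) => //; exists ord0.
move=> _ [_ [i _ <-] <-]; rewrite -(f_invF kinj i).
apply: le_trans (fx _); apply: ge_inf.
  by exists 0 => _ [? _ <-]; exact: edist_ge0.
by exists (f (invF kinj i)) => //; exists (invF kinj i).
Qed.

Lemma regular_unit_simplexP (d : nat) (x : 'I_d.+1 -> 'rV[Rl]_d) :
  (forall i j, i != j -> nsq (x i - x j) = 1) -> regular_unit_simplex x.
Proof. by move=> xreg i j ij; rewrite edistE xreg // sqrtr1. Qed.

Theorem mainTheorem4 :
  forall d : nat, (1 <= d)%N ->
  exists betad Cd : Rl, 0 < betad /\ 0 < Cd /\
  forall (S : set 'rV[Rl]_d) (beta : Rl),
    compact_set S ->
    diam S <= 1 + beta ->
    Jung d <= cheb_rad S ->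
    0 <= beta -> beta <= betad ->
    exists x : 'I_d.+1 -> 'rV[Rl]_d,
      regular_unit_simplex x /\
      forall W : set 'rV[Rl]_d, witness S W -> distH W (range x) <= Cd * beta.
Proof.
move=> d d0; have [C [C1 stab]] := @witness_stability Rl d d0.
have C4 : 0 < 4 * C by lra.
(* This threshold is the smallness condition [4 * C * beta <= 1] of [witness_stability]. *)
exists (4 * C)^-1, C; split; first by rewrite invr_gt0.
split; first lra.
move=> S beta cS dS _ b0; rewrite -[_^-1]mul1r ler_pdivlMr // mulrC => bC.
have SD y z : S y -> S z -> nsq (y - z) <= (1 + beta) ^+ 2.
  move=> Sy Sz; rewrite -edist_le; last lra.
  exact: le_trans (compact_edist_le cS Sy Sz) dS.
have [[W0 [W0S [w [_ W0E]] W0J]]|noW] := pselect (exists W, witness S W); last first.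
  have [x xreg] := @regular_exists Rl d d0.
  exists x; split; first exact: regular_unit_simplexP.
  by move=> W WS; case: noW; exists W.
subst W0; have wS i : S (w i) by apply: W0S; exists i.
have [|i j|x [xreg xnear]] := stab beta b0 bC w; [exact: cheb_rad_range | exact: SD |].
exists x; split; first exact: regular_unit_simplexP.
move=> W [WS [f [_ WE]] WJ]; subst W; have fS i : S (f i) by apply: WS; exists i.
have [|i j|i j|k [kinj fk]] := xnear f;
  [exact: cheb_rad_range | exact: SD | exact: SD |].
apply: (distH_range_le kinj) => j; rewrite edist_le //.
by rewrite mulr_ge0 //; lra.
Qed.
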